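(* For every formula $A$ of $\mathcal{L}_{PAL}$, if $\vDash_{PAL} A$, then the DHS $\Rightarrow A$ (a single dynamic sequent consisting of the single $\epsilon$-labelled component with empty antecedent and succedent $A$) is derivable in $\mathbf{DHS}_{PAL}$.
   Context: Formulas of $\mathcal{L}_{PAL}$ are generated by $A ::= p \mid \neg A \mid (A\wedge A) \mid \Box A \mid [A]A$ from a countable set of atoms. Semantics: an epistemic model is $M=(W,\sim,V)$ with $W$ a set, $\sim$ an equivalence relation on $W$, $V$ assigning to each atom a subset of $W$. Satisfaction and updated models are defined simultaneously: $M,w\vDash p$ iff $w\in V(p)$; $M,w\vDash\neg A$ iff not $M,w\vDash A$; $M,w\vDash A\wedge B$ iff both; $M,w\vDash\Box A$ iff $M,v\vDash A$ for all $v$ with $w\sim v$; $M,w\vDash[A]B$ iff ($M,w\vDash A$ implies $M_A,w\vDash B$), where $M_A=(W_A,\sim_A,V_A)$ with $W_A=\{w\in W: M,w\vDash A\}$, $\sim_A = \sim\cap W_A^2$, $V_A(p)=V(p)\cap W_A$. $\vDash_{PAL}A$ means $M,w\vDash A$ for all models $M$ and worlds $w$. Syntax of the calculus: a list of announcements is a finite (possibly empty, $\epsilon$) sequence of formulas, $\alpha\cdot A$ its extension by $A$. A sequent is $M\Rightarrow N$ ($M,N$ finite multisets); $A,\Gamma$ / $\Gamma,A$ add $A$ to antecedent / succedent. A dynamic sequent is $/\!/_{\alpha_1}\Gamma_1/\!/\cdots/\!/_{\alpha_n}\Gamma_n$ (components labelled by lists of announcements; $/\!/_\epsilon\Gamma$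 written $\Gamma$); a DHS is $X_1\mid\cdots\mid X_n$ of dynamic sequents. $G\mid X/\!/_\alpha M\Rightarrow N$ denotes a DHS with a dynamic sequent having component labelled $\alpha$ equal to $M\Rightarrow N$, $X$ the rest of that dynamic sequent and $G$ the rest of the DHS (possibly empty). Calculus $\mathbf{DHS}_{PAL}$: Axioms $G\mid X/\!/_\alpha p,M\Rightarrow N,p$. (L$\neg$) $G\mid X/\!/_\alpha M\Rightarrow N,A$ / $G\mid X/\!/_\alpha\neg A,M\Rightarrow N$; (R$\neg$) $G\mid X/\!/_\alpha A,M\Rightarrow N$ / $G\mid X/\!/_\alpha M\Rightarrow N,\neg A$; (L$\wedge$) $G\mid X/\!/_\alpha A,B,M\Rightarrow N$ / $G\mid X/\!/_\alpha A\wedge B,M\Rightarrow N$; (R$\wedge$) $G\mid X/\!/_\alpha M\Rightarrow N,A$ and $G\mid X/\!/_\alpha M\Rightarrow N,B$ / $G\mid X/\!/_\alpha M\Rightarrow N,A\wedge B$; (L$\Box_1$) $G\mid X/\!/_\alpha\Box A,A,M\Rightarrow N$ / $G\mid X/\!/_\alpha\Box A,M\Rightarrow N$; (R$\Box$) $G\mid X/\!/_\alpha M\Rightarrow N\mid/\!/_\alpha\Rightarrow A$ / $G\mid X/\!/_\alpha M\Rightarrow N,\Box A$; (L$\Box_2$) $G\mid X/\!/_\alpha\Box A,M\Rightarrow N\mid Y/\!/_\alpha A,P\Rightarrow Q$ / $G\mid X/\!/_\alpha\Box A,M\Rightarrow N\mid Y/\!/_\alpha P\Rightarrow Q$; (L$\Box_3$)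 with $\beta=B_1\cdots B_n$, $\overline{Y}=Y/\!/_{\alpha\cdot\beta}\Box A,\Delta$: premises $G\mid X/\!/_\alpha\Gamma,B_1\mid\overline{Y}$, $G\mid X/\!/_\alpha\Gamma/\!/_{\alpha\cdot B_1\cdots B_i}\Rightarrow B_{i+1}\mid\overline{Y}$ ($1\le i<n$), $G\mid X/\!/_\alpha\Gamma/\!/_{\alpha\cdot\beta}A\Rightarrow\ \mid\overline{Y}$, conclusion $G\mid X/\!/_\alpha\Gamma\mid Y/\!/_{\alpha\cdot\beta}\Box A,\Delta$; (L$[\cdot]$) $G\mid X/\!/_\alpha M\Rightarrow N,A/\!/_{\alpha\cdot A}M'\Rightarrow N'$ and $G\mid X/\!/_\alpha M\Rightarrow N/\!/_{\alpha\cdot A}B,M'\Rightarrow N'$ / $G\mid X/\!/_\alpha[A]B,M\Rightarrow N/\!/_{\alpha\cdot A}M'\Rightarrow N'$; (R$[\cdot]$) $G\mid X/\!/_\alpha A,M\Rightarrow N/\!/_{\alpha\cdot A}M'\Rightarrow N',B$ / $G\mid X/\!/_\alpha M\Rightarrow N,[A]B/\!/_{\alpha\cdot A}M'\Rightarrow N'$ (in both, if no $\alpha\cdot A$ component is in the conclusion, the premises — for (L$[\cdot]$) the right one — contain a new component $/\!/_{\alpha\cdot A}$ with $M',N'$ empty); (Lat) $G\mid X/\!/_\alpha p,M\Rightarrow N/\!/_{\alpha\cdot A}p,M'\Rightarrow N'$ / $G\mid X/\!/_\alpha M\Rightarrow N/\!/_{\alpha\cdot A}p,M'\Rightarrow N'$;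 (Rat) $G\mid X/\!/_\alpha M\Rightarrow N,p/\!/_{\alpha\cdot A}M'\Rightarrow N',p$ / $G\mid X/\!/_\alpha M\Rightarrow N/\!/_{\alpha\cdot A}M'\Rightarrow N',p$; (New) $G\mid X/\!/_\alpha\Rightarrow\ /\!/_{\alpha\cdot A}M\Rightarrow N$ / $G\mid X/\!/_{\alpha\cdot A}M\Rightarrow N$; (Recall) $G\mid X/\!/_\alpha A,M\Rightarrow N/\!/_{\alpha\cdot A}M'\Rightarrow N'$ / $G\mid X/\!/_\alpha M\Rightarrow N/\!/_{\alpha\cdot A}M'\Rightarrow N'$. (Notation ''premises / conclusion''.) *)

(* Defs.v *)
From Corelib Require Import RelationClasses.
From HB Require Import structures.
From mathcomp Require Import all_boot.
From mathcomp Require Import finmap multiset.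

Set Implicit Arguments.
Unset Strict Implicit.
Unset Printing Implicit Defensive.

Local Open Scope mset_scope.

Inductive form (atom : Type) : Type :=
| Atom of atom
| Neg of form atom
| And of form atom & form atom
| Box of form atom
| Ann of form atom & form atom. (* [Ann A B] is [A]B *)

Arguments Atom {atom} _.
Arguments Neg {atom} _.
Arguments And {atom} _ _.
Arguments Box {atom} _.
Arguments Ann {atom} _ _.

(* Formulas embed into generic trees, hence form a countType; this is what
   makes finite multisets of formulas available. *)
Section FormCountable.
Variable atom : countType.

Fixpoint form_encode (A : form atom) : GenTree.tree atom :=
  match A with
  | Atom p => GenTree.Leaf p
  | Neg A => GenTree.Node 0 [:: form_encode A]
  | And A B => GenTree.Node 1 [:: form_encode A; form_encode B]
  | Box A => GenTree.Node 2 [:: form_encode A]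
  | Ann A B => GenTree.Node 3 [:: form_encode A; form_encode B]
  end.

Fixpoint form_decode (t : GenTree.tree atom) : option (form atom) :=
  match t with
  | GenTree.Leaf p => Some (Atom p)
  | GenTree.Node 0 [:: t] => omap Neg (form_decode t)
  | GenTree.Node 1 [:: t; u] =>
      obind (fun A => omap (And A) (form_decode u)) (form_decode t)
  | GenTree.Node 2 [:: t] => omap Box (form_decode t)
  | GenTree.Node 3 [:: t; u] =>
      obind (fun A => omap (Ann A) (form_decode u)) (form_decode t)
  | _ => None
  end.

Lemma form_encodeK : pcancel form_encode form_decode.
Proof. by elim=> //= [A -> | A -> B -> | A -> | A -> B ->]. Qed.

HB.instance Definition _ := Countable.copy (form atom) (pcan_type form_encodeK).

End FormCountable.

Record model (atom : Type) : Type := Model {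
  world :> Type;
  acc : world -> world -> Prop;
  acc_equivalence : Equivalence acc;
  valuation : atom -> world -> Prop
}.

Section Semantics.
Variable atom : Type.
Implicit Types (M : model atom) (A B : form atom).

Lemma restrict_equivalence M (P : M -> Prop) :
  Equivalence (fun u v : {w : M | P w} => @acc atom M (sval u) (sval v)).
Proof.
have [r s t] := acc_equivalence M; split.
- by move=> u; exact: r.
- by move=> u v; exact: s.
- by move=> u v w; exact: t.
Qed.

Definition restrict M (P : M -> Prop) : model atom :=
  Model (restrict_equivalence P) (fun p u => valuation p (sval u)).

(* The updated model M_A is [restrict (fun v : M => sat A v)]. *)
Fixpoint sat A : forall M, M -> Prop :=
  match A with
  | Atom p => fun M w => valuation p w
  | Neg A => fun M w => ~ sat A w
  | And A B => fun M w => sat A w /\ sat B w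
  | Box A => fun M w => forall v, acc w v -> sat A v
  | Ann A B => fun M w =>
      forall h : sat A w,
        @sat B (restrict (fun v : M => sat A v)) (exist _ w h)
  end.

Definition valid A : Prop := forall M (w : M), sat A w.

End Semantics.

(* Addition of one element to a multiset, locked because unification problems
   between unfolded multiset operations do not terminate in practice. *)
HB.lock Definition madd (K : choiceType) (x : K) (A : {mset K}) : {mset K} :=
  x +` A.

Notation "x +: A" := (madd x A) (at level 60, right associativity).

Notation "[ 'at' a | M => N ]" := (a, (M%mset, N%mset))
  (at level 0, a at level 99, M at level 99, N at level 99,
   format "[ 'at'  a  |  M  =>  N ]").

Section Calculus.
Variable atom : countType.

(* A list of announcements, the most recent one last: alpha . A is
   [rcons a A], and the empty list epsilon is [::]. *)
Definition label := seq (form atom).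
Definition sequent := ({mset form atom} * {mset form atom})%type.
Definition component := (label * sequent)%type.
Definition dynseq := {mset component}.
Definition dhs := {mset dynseq}.

Implicit Types (p : atom) (A B : form atom) (M N P Q : {mset form atom}).
Implicit Types (a b : label) (c : component) (X Y : dynseq) (G : dhs).

(* Premises precede the conclusion.  In [(c +: X) +: G], the component [c]
   belongs to a dynamic sequent with remaining components [X], and [G] is the
   rest of the hypersequent. *)
Inductive derivable : dhs -> Prop :=

| Ax G X a M N p :
  derivable (([at a | Atom p +: M => Atom p +: N] +: X) +: G)

| LNeg G X a M N A :
  derivable (([at a | M => A +: N] +: X) +: G) ->
  derivable (([at a | Neg A +: M => N] +: X) +: G)

| RNeg G X a M N A :
  derivable (([at a | A +: M => N] +: X) +: G) ->
  derivable (([at a | M => Neg A +: N] +: X) +: G)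

| LAnd G X a M N A B :
  derivable (([at a | A +: B +: M => N] +: X) +: G) ->
  derivable (([at a | And A B +: M => N] +: X) +: G)

| RAnd G X a M N A B :
  derivable (([at a | M => A +: N] +: X) +: G) ->
  derivable (([at a | M => B +: N] +: X) +: G) ->
  derivable (([at a | M => And A B +: N] +: X) +: G)

| LBox1 G X a M N A :
  derivable (([at a | Box A +: A +: M => N] +: X) +: G) ->
  derivable (([at a | Box A +: M => N] +: X) +: G)

| RBox G X a M N A :
  derivable (([at a | M => N] +: X) +:
             (([at a | mset0 => A +: mset0] +: mset0) +: G)) ->
  derivable (([at a | M => Box A +: N] +: X) +: G)

| LBox2 G X Y a M N P Q A :
  derivable (([at a | Box A +: M => N] +: X) +:
             (([at a | A +: P => Q] +: Y) +: G)) ->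
  derivable (([at a | Box A +: M => N] +: X) +:
             (([at a | P => Q] +: Y) +: G))

(* Here beta = [b] is the nonempty list B_1 ... B_n with B_1 = [B], and
   [nth B b i] is B_(i+1). *)
| LBox3 G X Y a M N P Q A B b' (b : label := B :: b')
    (Ybar : dynseq := [at a ++ b | Box A +: P => Q] +: Y) :
  derivable (([at a | M => B +: N] +: X) +: (Ybar +: G)) ->
  (forall i, 1 <= i < size b ->
    derivable (([at a | M => N] +:
                ([at a ++ take i b | mset0 => nth B b i +: mset0] +: X)) +:
               (Ybar +: G))) ->
  derivable (([at a | M => N] +:
              ([at a ++ b | A +: mset0 => mset0] +: X)) +: (Ybar +: G)) ->
  derivable (([at a | M => N] +: X) +: (Ybar +: G))

| LAnn G X a M N M' N' A B :
  derivable (([at a | M => A +: N] +: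
              ([at rcons a A | M' => N'] +: X)) +: G) ->
  derivable (([at a | M => N] +:
              ([at rcons a A | B +: M' => N'] +: X)) +: G) ->
  derivable (([at a | Ann A B +: M => N] +:
              ([at rcons a A | M' => N'] +: X)) +: G)

| LAnn_new G X a M N A B :
  (forall c, c \in X -> c.1 != rcons a A) ->
  derivable (([at a | M => A +: N] +: X) +: G) ->
  derivable (([at a | M => N] +:
              ([at rcons a A | B +: mset0 => mset0] +: X)) +: G) ->
  derivable (([at a | Ann A B +: M => N] +: X) +: G)

| RAnn G X a M N M' N' A B :
  derivable (([at a | A +: M => N] +:
              ([at rcons a A | M' => B +: N'] +: X)) +: G) ->
  derivable (([at a | M => Ann A B +: N] +:
              ([at rcons a A | M' => N'] +: X)) +: G)

| RAnn_new G X a M N A B :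
  (forall c, c \in X -> c.1 != rcons a A) ->
  derivable (([at a | A +: M => N] +:
              ([at rcons a A | mset0 => B +: mset0] +: X)) +: G) ->
  derivable (([at a | M => Ann A B +: N] +: X) +: G)

| Lat G X a M N M' N' A p :
  derivable (([at a | Atom p +: M => N] +:
              ([at rcons a A | Atom p +: M' => N'] +: X)) +: G) ->
  derivable (([at a | M => N] +:
              ([at rcons a A | Atom p +: M' => N'] +: X)) +: G)

| Rat G X a M N M' N' A p :
  derivable (([at a | M => Atom p +: N] +:
              ([at rcons a A | M' => Atom p +: N'] +: X)) +: G) ->
  derivable (([at a | M => N] +:
              ([at rcons a A | M' => Atom p +: N'] +: X)) +: G)

| New G X a M N A :
  derivable (([at a | mset0 => mset0] +:
              ([at rcons a A | M => N] +: X)) +: G) ->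
  derivable (([at rcons a A | M => N] +: X) +: G)

| Recall G X a M N M' N' A :
  derivable (([at a | A +: M => N] +:
              ([at rcons a A | M' => N'] +: X)) +: G) ->
  derivable (([at a | M => N] +:
              ([at rcons a A | M' => N'] +: X)) +: G).

End Calculus.

(* Main.v *)
Require Import Defs.
From mathcomp Require Import all_boot.
From mathcomp Require Import finmap multiset.
From Stdlib Require Import Classical_Prop.

(* Since most rules consume their principal formula, and contraction is not a
   rule, backward proof search is run on states that record both the formulas
   present in the hypersequent and those consumed earlier.
   Only the new formulas of a premise count as progress, and every label and
   formula that occurs is bounded by the size of the root formula; if each
   world is moreover named by the component that [RBox] creates it with, the
   whole search lives in a finite set, so an underivable hypersequent extends
   to an underivable maximal state.  Its formulas, past and present, form a
   Hintikka set: a box on the left at a label that another world lacks is taken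
   care of by [LBox3], applied at the longest prefix that this world does have.
   The worlds with total accessibility and the antecedent atoms at the empty
   label then refute the root formula, by induction on the joint size of label
   and formula. *)

Set Implicit Arguments.
Unset Strict Implicit.
Unset Printing Implicit Defensive.

(** * Countermodels from Hintikka sets *)

Fixpoint form_size (atom : Type) (A : form atom) : nat :=
  match A with
  | Atom _ => 1
  | Neg A | Box A => (form_size A).+1
  | And A B | Ann A B => (form_size A + form_size B).+1
  end.

Definition label_size (atom : Type) (a : seq (form atom)) : nat :=
  sumn (map (@form_size atom) a).

Lemma form_size_gt0 (atom : Type) (A : form atom) : 0 < form_size A.
Proof. by case: A. Qed.

Lemma label_size_rcons (atom : Type) (a : seq (form atom)) A :
  label_size (rcons a A) = label_size a + form_size A.
Proof. by rewrite /label_size map_rcons sumn_rcons. Qed.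

Lemma label_size_cat (atom : Type) (a b : seq (form atom)) :
  label_size (a ++ b) = label_size a + label_size b.
Proof. by rewrite /label_size map_cat sumn_cat. Qed.

(** * Truth relative to a subset of worlds, and iterated announcements *)

Section Relativization.
Variables (atom W : Type) (V : atom -> W -> Prop).
Implicit Types (A B : form atom) (P : W -> Prop) (a b : seq (form atom)).

(* Satisfaction in the submodel on [P] of the model on [W] with the total
   accessibility relation. *)
Fixpoint holds P A (w : W) : Prop :=
  match A with
  | Atom p => V p w
  | Neg A => ~ holds P A w
  | And A B => holds P A w /\ holds P B w
  | Box A => forall v, P v -> holds P A v
  | Ann A B => holds P A w -> holds (fun v => P v /\ holds P A v) B w
  end.

(** An update replaces worlds by pairs carrying a proof of satisfaction, so a model is compared with
    [P] along a map [f] whose image is exactly [P]. The induction on [A] must range over all such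
    models and maps: the announcement case passes to the restricted model, with [sval] composed with
    [f]. *)
Lemma sat_holds A (M : model atom) (f : M -> W) P :
    (forall w, P (f w)) -> (forall v, P v -> exists w, f w = v) ->
    (forall u v : M, acc u v) ->
    (forall p w, valuation p w <-> V p (f w)) ->
  forall w : M, sat A w <-> holds P A (f w).
Proof.
elim: A M f P => [p|A IH|A IHA B IHB|A IH|A IHA B IHB] M f P fP Pf tot val w /=.
- exact: val.
- have h := IH M f P fP Pf tot val w; tauto.
- have hA := IHA M f P fP Pf tot val w; have hB := IHB M f P fP Pf tot val w; tauto.
- split=> [h v /Pf[u <-]|h v _]; first by apply/(IH M f P) => //; apply: h.
  by apply/(IH M f P) => //; apply: h.
- pose Q v := P v /\ holds P A v.
  have IHA' : forall v : M, sat A v <-> holds P A (f v) by exact: IHA.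
  have IHB' : forall u : restrict (fun v : M => sat A v),
      sat B u <-> holds Q B (f (sval u)).
    apply: (IHB (restrict (fun v : M => sat A v)) (fun u => f (sval u)) Q).
    + by case=> v sv; split=> //; apply/IHA'.
    + move=> v [/Pf[u <-] hu].
      by exists (exist _ u (proj2 (IHA' u) hu)).
    + by move=> u v; apply: tot.
    + by move=> p u; apply: val.
  split=> [h hA|h hA].
    have sA : sat A w by apply/IHA'.
    exact/(IHB' (exist _ w sA))/h.
  by apply/IHB'; apply: h; apply/IHA'.
Qed.

(** The domain of the model obtained by announcing the formulas of [a] one after the other, each
    evaluated in the submodel left by its predecessors. *)
Definition survives a : W -> Prop :=
  foldl (fun P A v => P v /\ holds P A v) (fun=> True) a.

Lemma survives_rcons a A w :
  survives (rcons a A) w <-> survives a w /\ holds (survives a) A w.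
Proof. by rewrite /survives -cats1 foldl_cat. Qed.

Lemma survives_prefix a b w : survives (a ++ b) w -> survives a w.
Proof.
elim/last_ind: b => [|b B IH]; first by rewrite cats0.
by rewrite -rcons_cat survives_rcons => -[/IH].
Qed.

End Relativization.

(** * Hintikka sets for labelled formulas and their truth lemma *)

Section Hintikka.
Variables (atom W : Type).
Variables (S : W -> seq (form atom) -> Prop).
Variables (T : W -> seq (form atom) -> bool -> form atom -> Prop).

(* [S w a]: world [w] has an [a]-component; [T w a true A] and [T w a false A]:
   [A] belongs to its antecedent, respectively to its succedent. *)
Record hintikka : Prop := Hintikka {
  h_recall w a A : S w (rcons a A) -> S w a /\ T w a true A;
  h_site w a b A : T w a b A -> S w a;
  h_consistent w a p : T w a true (Atom p) -> ~ T w a false (Atom p);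
  h_atom w a b A p : T w (rcons a A) b (Atom p) -> T w a b (Atom p);
  h_neg w a b A : T w a b (Neg A) -> T w a (~~ b) A;
  h_and_left w a A B : T w a true (And A B) -> T w a true A /\ T w a true B;
  h_and_right w a A B : T w a false (And A B) -> T w a false A \/ T w a false B;
  h_box_left w a A : T w a true (Box A) -> forall v,
    T v a true A \/ exists c B d, a = rcons c B ++ d /\ T v c false B;
  h_box_right w a A : T w a false (Box A) -> exists v, T v a false A;
  h_ann_left w a A B : T w a true (Ann A B) ->
    T w a false A \/ T w (rcons a A) true B;
  h_ann_right w a A B : T w a false (Ann A B) ->
    T w a true A /\ T w (rcons a A) false B
}.

Hypothesis H : hintikka.

Let V (p : atom) w := T w [::] true (Atom p).

Lemma hintikka_atom w a b p : T w a b (Atom p) -> T w [::] b (Atom p).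
Proof. by elim/last_ind: a => // a A IH /(h_atom H). Qed.

(** Induction on [label_size a + form_size A]. Passing from [Ann A B] at [a] to [B] at [rcons a A]
    moves the size of [A] into the label and still gains one, and the truth of the formulas
    announced in [a] is covered by the same induction. *)
Lemma truth_lemma w a b A : T w a b A ->
  if b then holds V (survives V a) A w else ~ holds V (survives V a) A w.
Proof.
suff main n : forall w a b A, label_size a + form_size A <= n -> T w a b A ->
    if b then holds V (survives V a) A w else ~ holds V (survives V a) A w.
  exact: (main _ _ _ _ _ (leqnn _)).
elim: n => [|n IH] {}w {}a {}b {}A.
  by rewrite leqn0 addn_eq0 (gtn_eqF (form_size_gt0 A)) andbF.
(* By [h_recall] each announced formula is on the left at the prefix before it. Prefix and formula
   together measure at most [label_size c], so the induction hypothesis makes the formula true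
   there. *)
have surv v c : label_size c <= n -> S v c -> survives V c v.
  elim/last_ind: c => [|c C IHc]; first by [].
  rewrite label_size_rcons => le_n /(h_recall H)[Sc Tc].
  apply/survives_rcons; split; last exact: (IH _ _ true).
  by apply: IHc => //; apply: leq_trans (leq_addr _ _) le_n.
case: A => [p|A|A B|A|A B] /=; rewrite ?addnS ltnS => le_n.
- case: b => Tp; first exact: hintikka_atom Tp.
  by move=> /(h_consistent H); apply; apply: hintikka_atom Tp.
- move=> /(h_neg H) Tn; have := IH _ _ _ _ le_n Tn.
  by case: b {Tn} => //= hA nA; apply: nA.
- have leA : label_size a + form_size A <= n.
    by apply: leq_trans le_n; rewrite leq_add2l leq_addr.
  have leB : label_size a + form_size B <= n.
    by apply: leq_trans le_n; rewrite leq_add2l leq_addl.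
  case: b.
    move=> /(h_and_left H)[TA TB].
    by split; [apply: (IH _ _ true) TA | apply: (IH _ _ true) TB].
  move=> /(h_and_right H)[TA|TB] [hA hB].
    exact: (IH _ _ false _ leA TA).
  exact: (IH _ _ false _ leB TB).
- case: b.
    move=> /(h_box_left H) hbox v sv.
    have [Tv|[c [B [d [Ea Tc]]]]] := hbox v; first exact: (IH _ _ true) Tv.
    (* A world surviving [a] satisfies [B] after [c], whereas [B] on the right at [c] makes it
       false. The induction hypothesis applies because [c] and [B] both sit inside [a]. *)
    rewrite Ea in sv.
    have [_ hB] := proj1 (survives_rcons V c B v) (survives_prefix sv).
    case: (IH v c false B _ Tc hB); apply: leq_trans le_n.
    by rewrite Ea label_size_cat label_size_rcons -addnA leq_addr.
  move=> /(h_box_right H)[v Tv] hbox.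
  (* The witness counts against the box only if it survives [a], which follows from its having an
     [a]-component. *)
  have := IH v a false A le_n Tv; apply; apply: hbox; apply: surv.
    by apply: leq_trans le_n; apply: leq_addr.
  exact: h_site Tv.
- have leA : label_size a + form_size A <= n.
    by apply: leq_trans le_n; rewrite leq_add2l leq_addr.
  have leB : label_size (rcons a A) + form_size B <= n.
    by rewrite label_size_rcons -addnA.
  have eqB P : holds V (fun v => survives V a v /\ holds V (survives V a) A v) B P
      = holds V (survives V (rcons a A)) B P.
    by rewrite /survives -cats1 foldl_cat.
  rewrite /= eqB; case: b.
    move=> /(h_ann_left H)[TA|TB] hA; first by case: (IH _ _ false _ leA TA).
    exact: (IH _ _ true _ leB TB).
  move=> /(h_ann_right H)[TA TB] hAB.
  by apply: (IH _ _ false _ leB TB); apply: hAB; apply: (IH _ _ true _ leA TA).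
Qed.

Lemma total_equivalence : RelationClasses.Equivalence (fun _ _ : W => True).
Proof. by split. Qed.

Lemma hintikka_not_valid w A : T w [::] false A -> ~ valid A.
Proof.
move=> TA vA; apply: (truth_lemma TA).
pose M : model atom := Model total_equivalence V.
have [+ _] : sat A (w : M) <-> holds V (survives V [::]) A w.
  by apply: (@sat_holds _ _ _ A M id) => // v _; exists v.
by apply; apply: vA.
Qed.

End Hintikka.

(** * The calculus on sets of facts *)

Local Open Scope mset_scope.

Lemma maddCA (K : choiceType) (x y : K) (m : {mset K}) :
  x +: (y +: m) = y +: (x +: m).
Proof. by rewrite !madd.unlock msetDCA. Qed.

Lemma madd0 (K : choiceType) (x : K) : x +: mset0 = [mset x].
Proof. by rewrite madd.unlock msetD0. Qed.

(** Hypersequents will be read off lists by folding insertions that commute, so their value depends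
    on the lists only up to permutation. *)
Lemma foldr_perm (I : eqType) (R : Type) (f : I -> R -> R) (z : R) (s t : seq I) :
  (forall x y r, f x (f y r) = f y (f x r)) ->
  perm_eq s t -> foldr f z s = foldr f z t.
Proof.
move=> fCA; elim: s t => [|x s IH] t; first by move/perm_size/esym/size0nil=> ->.
move=> st; have xt : x \in t by rewrite -(perm_mem st) mem_head.
rewrite -(cat_take_drop (index x t) t) (drop_index xt) in st *.
move: (take _ _) (drop _ _) st => t1 t2.
rewrite perm_sym perm_catC /= perm_cons perm_catC perm_sym => /IH /= ->.
by elim: t1 => //= y t1 <-.
Qed.

Section Sites.
Variable atom : countType.

(* The name [(a, A)] of a world records that [RBox] created it with the component
   [at a | mset0 => A]; the initial world is named [([::], A)].  A fact
   [(s, b, A)] puts [A] in the antecedent ([b = true]) or in the succedent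
   ([b = false]) of the component at the site [s]. *)
Definition wname : choiceType := (label atom * form atom)%type.
Definition site : choiceType := (wname * label atom)%type.
Definition fact : choiceType := (site * bool * form atom)%type.

Implicit Types (w v : wname) (s t : site) (f : fact) (a c : label atom) (b : bool).
Implicit Types (ks : seq wname) (C : seq site) (F D E : seq fact).
Implicit Types (A B : form atom) (p : atom).

(** Repeated entries of [F] count as repeated formulas. Folding makes a fact consed onto [F] compute
    to a single [+:], which is the shape the rules expect. *)
Definition facts_at (x : site * bool) F : {mset form atom} :=
  foldr (fun f m => if f.1 == x then f.2 +: m else m) mset0 F.

Definition cmp s F : component atom :=
  [at s.2 | facts_at (s, true) F => facts_at (s, false) F].

Definition dyn w C F : dynseq atom :=
  foldr (fun s X => if s.1 == w then cmp s F +: X else X) mset0 C.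

Definition hyp ks C F : dhs atom :=
  foldr (fun w G => dyn w C F +: G) mset0 ks.

Lemma perm_facts_at x F F' : perm_eq F F' -> facts_at x F = facts_at x F'.
Proof.
apply: foldr_perm => f g m.
by case: (f.1 == x); case: (g.1 == x) => //; rewrite maddCA.
Qed.

Lemma perm_cmp s F F' : perm_eq F F' -> cmp s F = cmp s F'.
Proof. by move=> FF'; rewrite /cmp !(perm_facts_at _ FF'). Qed.

Lemma perm_dyn w C C' F F' :
  perm_eq C C' -> perm_eq F F' -> dyn w C F = dyn w C' F'.
Proof.
move=> CC' FF'; have -> : dyn w C' F' = dyn w C' F.
  by rewrite /dyn; elim: (C') => //= s C0 ->; rewrite (perm_cmp _ FF').
apply: foldr_perm CC' => s t m.
by case: (s.1 == w); case: (t.1 == w) => //; rewrite maddCA.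
Qed.

Lemma perm_hyp ks ks' C C' F F' :
  perm_eq ks ks' -> perm_eq C C' -> perm_eq F F' -> hyp ks C F = hyp ks' C' F'.
Proof.
move=> kk' CC' FF'; have -> : hyp ks' C' F' = hyp ks' C F.
  by rewrite /hyp; elim: (ks') => //= w k0 ->; rewrite (perm_dyn _ CC' FF').
by apply: foldr_perm kk' => w v m; rewrite maddCA.
Qed.

Lemma facts_at_nil x F : (forall f, f \in F -> f.1 != x) -> facts_at x F = mset0.
Proof.
elim: F => //= f F IH h; rewrite (negPf (h f (mem_head _ _))).
by apply: IH => g gF; apply: h; rewrite inE gF orbT.
Qed.

Lemma dyn_cat_facts w C E F :
  (forall f, f \in E -> (f.1.1.1 != w) || (f.1.1 \notin C)) ->
  dyn w C (E ++ F) = dyn w C F.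
Proof.
move=> h.
have facts_cat s b : s \in C -> s.1 == w -> facts_at (s, b) (E ++ F) = facts_at (s, b) F.
  move=> sC sw; elim: E h => //= f E IH h; rewrite IH; last first.
    by move=> g gE; apply: h; rewrite inE gE orbT.
  case: (f.1 =P (s, b)) (h f (mem_head _ _)) => // ->.
  by rewrite /= sw sC.
elim: C {h} facts_cat => //= s C IH h; rewrite IH; last first.
  by move=> t b tC; apply: h; rewrite inE tC orbT.
by case: ifP => // sw; rewrite /cmp !h ?mem_head.
Qed.

Lemma hyp_cat_facts ks C E F :
  (forall f, f \in E -> f.1.1.1 \notin ks) -> hyp ks C (E ++ F) = hyp ks C F.
Proof.
elim: ks => //= w ks IH h; rewrite IH; last first.
  by move=> f /h; rewrite inE negb_or => /andP[].
rewrite dyn_cat_facts // => f /h; by rewrite inE negb_or => /andP[-> _].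
Qed.

Lemma hyp_cat_sites ks H C F :
  (forall s, s \in H -> s.1 \notin ks) -> hyp ks (H ++ C) F = hyp ks C F.
Proof.
move=> h; have dyn_cat w : w \in ks -> dyn w (H ++ C) F = dyn w C F.
  move=> wk; elim: H h => //= s H IH h; rewrite IH; last first.
    by move=> t tH; apply: h; rewrite inE tH orbT.
  by case: (s.1 =P w) (h s (mem_head _ _)) => // ->; rewrite wk.
elim: ks {h} dyn_cat => //= w ks IH h; rewrite h ?mem_head // IH // => v vk.
by apply: h; rewrite inE vk orbT.
Qed.

Lemma dyn_nil w C F : (forall s, s \in C -> s.1 != w) -> dyn w C F = mset0.
Proof.
elim: C => //= s C IH h; rewrite (negPf (h s (mem_head _ _))).
by apply: IH => t tC; apply: h; rewrite inE tC orbT.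
Qed.

Lemma dyn_label w C F (x : component atom) : x \in dyn w C F -> (w, x.1) \in C.
Proof.
elim: C => [|s C IH] /=; first by rewrite in_mset0.
case: eqP => [sw|_]; last by rewrite inE => /IH->; rewrite orbT.
rewrite madd.unlock in_msetD in_mset1 inE => /orP[/eqP->|/IH->].
  by rewrite -sw -surjective_pairing eqxx.
by rewrite orbT.
Qed.

(** * The rules of the calculus, read on sites and facts *)

Section Rules.
Variables (ks : seq wname) (C : seq site) (F : seq fact).
Hypotheses (uks : uniq ks) (uC : uniq C).
Hypothesis FC : forall f, f \in F -> f.1.1 \in C.

(* The remaining components [X] of the world [w] do not depend on the added
   sites [N] and facts [E]: a single [X] serves the conclusion and all premises
   of a rule. *)
Lemma focus w (H : seq site) :
    w \in ks -> {subset H <= C} -> uniq H -> (forall s, s \in H -> s.1 = w) ->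
  exists X, (forall x : component atom, x \in X -> (w, x.1) \in C) /\ forall N E,
    (forall s, s \in N -> s \notin C /\ s.1 = w) ->
    (forall f, f \in E -> f.1.1 \in N ++ H) ->
    hyp ks (N ++ C) (E ++ F) =
      foldr (fun s Y => cmp s (E ++ F) +: Y) X (N ++ H) +:
        hyp (rem w ks) C F.
Proof.
move=> wk HC uH Hw; pose C' := [seq s <- C | s \notin H].
have Cperm : perm_eq C (H ++ C').
  apply: uniq_perm => //.
    rewrite cat_uniq uH filter_uniq // andbT; apply/hasPn => s.
    by rewrite mem_filter => /andP[].
  move=> s; rewrite mem_cat mem_filter; case: (boolP (s \in H)) => //= /HC ->//.
exists (dyn w C' F); split=> [c /dyn_label|N E Nw EH].
  by rewrite mem_filter => /andP[].
have wrem : w \notin rem w ks by rewrite mem_rem_uniq // inE eqxx.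
have NHw s : s \in N ++ H -> s.1 = w.
  by rewrite mem_cat => /orP[/Nw[]|/Hw].
rewrite (perm_hyp (perm_to_rem wk) (perm_refl _) (perm_refl _)) /=.
rewrite hyp_cat_facts ?hyp_cat_sites; first last.
- by move=> f /EH/NHw->.
- by move=> s /Nw[_ ->].
congr (_ +: _).
have -> : dyn w (N ++ C) (E ++ F) = dyn w ((N ++ H) ++ C') (E ++ F).
  by apply: perm_dyn => //; rewrite -catA perm_cat2l.
(* The facts of [E] lie at sites of [N ++ H], and [C'] contains none of these, so the remaining
   components do not see [E]. *)
have -> : dyn w C' F = dyn w C' (E ++ F).
  rewrite dyn_cat_facts // => f /EH fNH; rewrite (NHw _ fNH) eqxx /=.
  move: fNH; rewrite mem_cat mem_filter.
  by case/orP => [/Nw[/negPf-> _]|->]; rewrite ?andbF.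
elim: (N ++ H) NHw => //= s L IH Lw; rewrite Lw ?mem_head // eqxx IH // => t tL.
by apply: Lw; rewrite inE tL orbT.
Qed.


Lemma facts_at_cons x f L :
  facts_at x (f :: L) = if f.1 == x then f.2 +: facts_at x L else facts_at x L.
Proof. by []. Qed.

Lemma facts_at_new s b : s \notin C -> facts_at (s, b) F = mset0.
Proof.
move=> sC; apply: facts_at_nil => f /FC fC; apply: contraNneq sC => fs.
by rewrite fs in fC.
Qed.

Lemma rcons_eqF a A : (rcons a A == a) = false.
Proof. by apply/eqP => /(congr1 size)/eqP; rewrite size_rcons gtn_eqF. Qed.

Lemma eqF_rcons a A : (a == rcons a A) = false.
Proof. by rewrite eq_sym rcons_eqF. Qed.

Let factsE := (facts_at_cons, xpair_eqE, eqxx, rcons_eqF, eqF_rcons).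

Section OneSite.
Variables (w : wname) (a : label atom).
Hypotheses (wk : w \in ks) (sC : (w, a) \in C).
Let s : site := (w, a).

Lemma focus_site : exists X, forall E, (forall f, f \in E -> f.1.1 = s) ->
  hyp ks C (E ++ F) = (cmp s (E ++ F) +: X) +: hyp (rem w ks) C F.
Proof.
have [t|//|t|X [_ EX]] := @focus w [:: s] wk; try by rewrite inE => /eqP->.
by exists X => E Es; rewrite (EX [::]) // => f /Es->; rewrite mem_head.
Qed.

(** For rules that create a component. The first property of [X] yields the side condition of
    [LAnn_new] and [RAnn_new], and the same [X] serves the hypersequents with and without [t]. *)
Lemma focus_new_site t : t \notin C -> t.1 = w ->
  exists X, (forall x : component atom, x \in X -> x.1 != t.2) /\
   (forall E, (forall f, f \in E -> f.1.1 = s) ->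
    hyp ks C (E ++ F) = (cmp s (E ++ F) +: X) +: hyp (rem w ks) C F)
  /\ (forall E, (forall f, f \in E -> f.1.1 \in [:: t; s]) ->
    hyp ks (t :: C) (E ++ F) =
      (cmp s (E ++ F) +: (cmp t (E ++ F) +: X)) +: hyp (rem w ks) C F).
Proof.
move=> tC tw.
have [u|//|u|X [XC EX]] := @focus w [:: s] wk; try by rewrite inE => /eqP->.
exists X; split=> [c /XC|]; last split=> E Es.
- by apply: contraTneq => ->; rewrite -tw -surjective_pairing.
-  by rewrite (EX [::]) // => f /Es->; rewrite mem_head.
- by rewrite (EX [:: t]) /= 1?maddCA // => u; rewrite inE => /eqP->.
Qed.

Lemma focus_two_sites t : t \in C -> t != s -> t.1 = w ->
  exists X, forall E, (forall f, f \in E -> f.1.1 \in [:: s; t]) ->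
    hyp ks C (E ++ F) =
      (cmp s (E ++ F) +: (cmp t (E ++ F) +: X)) +: hyp (rem w ks) C F.
Proof.
move=> tC ts tw.
have [u||u|X [_ EX]] := @focus w [:: s; t] wk.
- by rewrite !inE => /orP[]/eqP->.
- by rewrite /= inE eq_sym ts.
- by rewrite !inE => /orP[]/eqP->.
by exists X => E Es; rewrite (EX [::]).
Qed.

Local Notation der := (@derivable atom).

Lemma der_axiom p : der (hyp ks C [:: (s, true, Atom p), (s, false, Atom p) & F]).
Proof.
have [X EX] := focus_site.
rewrite (EX [:: (s, true, Atom p); (s, false, Atom p)]); last first.
  by move=> f; rewrite !inE => /orP[]/eqP->.
rewrite /cmp !factsE; exact: Ax.
Qed.

Lemma der_neg b A :
  der (hyp ks C ((s, ~~ b, A) :: F)) -> der (hyp ks C ((s, b, Neg A) :: F)).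
Proof.
have [X EX] := focus_site.
rewrite (EX [:: (s, ~~ b, A)]) ?(EX [:: (s, b, Neg A)]); last 2 first.
- by move=> f; rewrite inE => /eqP->.
- by move=> f; rewrite inE => /eqP->.
rewrite /cmp !factsE; case: b => /=; [exact: LNeg | exact: RNeg].
Qed.


Lemma der_and_left A B :
  der (hyp ks C [:: (s, true, A), (s, true, B) & F]) ->
  der (hyp ks C ((s, true, And A B) :: F)).
Proof.
have [X EX] := focus_site.
rewrite (EX [:: (s, true, A); (s, true, B)]) ?(EX [:: (s, true, And A B)]).
- rewrite /cmp !factsE; exact: LAnd.
- by move=> f; rewrite inE => /eqP->.
- by move=> f; rewrite !inE => /orP[]/eqP->.
Qed.

Lemma der_and_right A B :
  der (hyp ks C ((s, false, A) :: F)) -> der (hyp ks C ((s, false, B) :: F)) ->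
  der (hyp ks C ((s, false, And A B) :: F)).
Proof.
have [X EX] := focus_site.
rewrite (EX [:: (s, false, A)]) ?(EX [:: (s, false, B)])
  ?(EX [:: (s, false, And A B)]); try by move=> f; rewrite inE => /eqP->.
rewrite /cmp !factsE; exact: RAnd.
Qed.

Lemma der_box_self A :
  der (hyp ks C [:: (s, true, Box A), (s, true, A) & F]) ->
  der (hyp ks C ((s, true, Box A) :: F)).
Proof.
have [X EX] := focus_site.
rewrite (EX [:: (s, true, Box A); (s, true, A)]) ?(EX [:: (s, true, Box A)]).
- rewrite /cmp !factsE; exact: LBox1.
- by move=> f; rewrite inE => /eqP->.
- by move=> f; rewrite !inE => /orP[]/eqP->.
Qed.

Lemma der_box_right v A : v \notin ks ->
  der (hyp (v :: ks) ((v, a) :: C) ((v, a, false, A) :: F)) ->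
  (forall t, t \in C -> t.1 \in ks) ->
  der (hyp ks C ((s, false, Box A) :: F)).
Proof.
move=> vk; have [X EX] := focus_site => + Ck.
rewrite /= eqxx (@hyp_cat_sites _ [:: (v, a)]); last first.
  by move=> t; rewrite inE => /eqP->.
rewrite (@hyp_cat_facts _ _ [:: _]); last by move=> t; rewrite inE => /eqP->.
(* Old sites belong to worlds of [ks], so the dynamic sequent of the fresh world [v] has only the
   new component, as [RBox] demands. *)
have Cv t : t \in C -> t.1 != v.
  by move=> /Ck tk; apply: contraNneq vk => <-.
rewrite (dyn_nil _ Cv) (EX [:: (s, false, Box A)]); last first.
  by move=> f; rewrite inE => /eqP->.
have vaC : ((v, a) : site) \notin C by apply: contra vk => /Ck.
rewrite (EX [::]) // /cmp !factsE /= !(facts_at_new _ vaC) maddCA; exact: RBox.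
Qed.

Let t A : site := (w, rcons a A).

Lemma der_ann_left A B : t A \in C ->
  der (hyp ks C ((s, false, A) :: F)) -> der (hyp ks C ((t A, true, B) :: F)) ->
  der (hyp ks C ((s, true, Ann A B) :: F)).
Proof.
move=> tC; have [||X EX] := focus_two_sites tC => //.
  by rewrite xpair_eqE rcons_eqF andbF.
rewrite (EX [:: (s, false, A)]) ?(EX [:: (t A, true, B)])
  ?(EX [:: (s, true, Ann A B)]);
  try by move=> f; rewrite !inE => /eqP->; rewrite eqxx ?orbT.
rewrite /cmp !factsE /= ?andbF; exact: LAnn.
Qed.

Lemma der_ann_left_new A B : t A \notin C ->
  der (hyp ks C ((s, false, A) :: F)) ->
  der (hyp ks (t A :: C) ((t A, true, B) :: F)) ->
  der (hyp ks C ((s, true, Ann A B) :: F)).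
Proof.
move=> tC; have [//|X [XA [EX EX']]] := focus_new_site tC.
rewrite (EX [:: (s, false, A)]) ?(EX' [:: (t A, true, B)])
  ?(EX [:: (s, true, Ann A B)]);
  try by move=> f; rewrite !inE => /eqP->; rewrite ?eqxx ?orbT.
rewrite /cmp !factsE /= ?andbF !(facts_at_new _ tC); exact: LAnn_new.
Qed.

Lemma der_ann_right A B : t A \in C ->
  der (hyp ks C [:: (s, true, A), (t A, false, B) & F]) ->
  der (hyp ks C ((s, false, Ann A B) :: F)).
Proof.
move=> tC; have [||X EX] := focus_two_sites tC => //.
  by rewrite xpair_eqE rcons_eqF andbF.
rewrite (EX [:: (s, true, A); (t A, false, B)]) ?(EX [:: (s, false, Ann A B)]);
  try by move=> f; rewrite !inE => /orP[]/eqP->; rewrite eqxx ?orbT.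
- rewrite /cmp !factsE /= ?andbF; exact: RAnn.
- by move=> f; rewrite !inE => /eqP->; rewrite eqxx.
Qed.

Lemma der_ann_right_new A B : t A \notin C ->
  der (hyp ks (t A :: C) [:: (s, true, A), (t A, false, B) & F]) ->
  der (hyp ks C ((s, false, Ann A B) :: F)).
Proof.
move=> tC; have [//|X [XA [EX EX']]] := focus_new_site tC.
rewrite (EX' [:: (s, true, A); (t A, false, B)]) ?(EX [:: (s, false, Ann A B)]);
  try by move=> f; rewrite !inE => /orP[]/eqP->; rewrite ?eqxx ?orbT.
- rewrite /cmp !factsE /= ?andbF !(facts_at_new _ tC); exact: RAnn_new.
- by move=> f; rewrite !inE => /eqP->.
Qed.

Lemma der_recall A : t A \in C ->
  der (hyp ks C ((s, true, A) :: F)) -> der (hyp ks C F).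
Proof.
move=> tC; have [||X EX] := focus_two_sites tC => //.
  by rewrite xpair_eqE rcons_eqF andbF.
rewrite (EX [:: (s, true, A)]) ?(EX [::]) //;
  last by move=> f; rewrite !inE => /eqP->; rewrite eqxx.
rewrite /cmp !factsE /= ?andbF; exact: Recall.
Qed.

Lemma der_atom A b p : t A \in C ->
  der (hyp ks C [:: (s, b, Atom p), (t A, b, Atom p) & F]) ->
  der (hyp ks C ((t A, b, Atom p) :: F)).
Proof.
move=> tC; have [||X EX] := focus_two_sites tC => //.
  by rewrite xpair_eqE rcons_eqF andbF.
rewrite (EX [:: (s, b, Atom p); (t A, b, Atom p)]) ?(EX [:: (t A, b, Atom p)]);
  try by move=> f; rewrite !inE => /orP[]/eqP->; rewrite ?eqxx ?orbT.
- by rewrite /cmp !factsE /= ?andbF; case: b => /=; [exact: Lat | exact: Rat].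
- by move=> f; rewrite !inE => /eqP->; rewrite eqxx orbT.
Qed.

End OneSite.

Lemma der_new w a A : w \in ks -> (w, rcons a A) \in C -> (w, a) \notin C ->
  derivable (hyp ks ((w, a) :: C) F) -> derivable (hyp ks C F).
Proof.
move=> wk sC tC; have [//|X [XA [EX EX']]] := focus_new_site wk sC tC.
rewrite (EX' [::]) ?(EX [::]) // /cmp !(facts_at_new _ tC) maddCA; exact: New.
Qed.

End Rules.

(** * Box rules that relate two different worlds *)

Section TwoWorlds.
Variables (ks : seq wname) (C : seq site) (F : seq fact).
Hypotheses (uks : uniq ks) (uC : uniq C).
Variables (w v : wname) (a c : label atom) (A : form atom).
Hypotheses (wk : w \in ks) (vk : v \in ks) (vw : v != w).
Hypotheses (sC : (w, a) \in C) (sA : (w, a, true, Box A) \in F).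
Hypothesis vC : (v, c) \in C.

(** The world [w] with its boxed formula is a fixed context in [LBox2] and [LBox3], while only [v]
    varies between premises. Focusing on [v] first and then on [w] in the rest gives one context for
    all of them. *)
Lemma focus_two_worlds : exists X Y M N G, forall L E,
    (forall s, s \in L -> s \notin C /\ s.1 = v) ->
    (forall f, f \in E -> f.1.1 \in L ++ [:: (v, c)]) ->
  hyp ks (L ++ C) (E ++ F) =
    foldr (fun s Z => cmp s (E ++ F) +: Z) X (L ++ [:: (v, c)]) +:
    (([at a | Box A +: M => N] +: Y) +: G).
Proof.
have [s|//|s|X [_ EX]] := @focus _ _ F uks uC v [:: (v, c)] vk;
  try by rewrite inE => /eqP->.
have wrem : w \in rem v ks by rewrite mem_rem_uniq // inE eq_sym vw.
have [s|//|s|Y [_ EY]] := @focus _ _ F (rem_uniq v uks) uC w [:: (w, a)] wrem;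
  try by rewrite inE => /eqP->.
exists X, Y, (facts_at (w, a, true) (rem (w, a, true, Box A) F)).
exists (facts_at (w, a, false) F), (hyp (rem w (rem v ks)) C F) => L E hL hE.
have /= EY0 := EY [::] [::]; rewrite EX // EY0 //.
by rewrite /cmp (perm_facts_at (w, a, true) (perm_to_rem sA)) facts_at_cons eqxx.
Qed.

End TwoWorlds.

Section BoxLeft.
Variables (ks : seq wname) (C : seq site) (F : seq fact).
Hypotheses (uks : uniq ks) (uC : uniq C).
Hypothesis FC : forall f, f \in F -> f.1.1 \in C.
Variables (w v : wname) (A : form atom).
Hypotheses (wk : w \in ks) (vk : v \in ks) (vw : v != w).

Lemma der_box_other a :
  (w, a) \in C -> (w, a, true, Box A) \in F -> (v, a) \in C ->
  derivable (hyp ks C ((v, a, true, A) :: F)) -> derivable (hyp ks C F).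
Proof.
move=> sC sA vC; have [X [Y [M [N [G E]]]]] := focus_two_worlds uks uC wk vk vw sC sA vC.
rewrite (E [::] [:: (v, a, true, A)]) ?(E [::] [::]) //=; last first.
  by move=> f; rewrite !inE => /eqP->.
rewrite /cmp !facts_at_cons !xpair_eqE !eqxx /= => h.
by rewrite maddCA; apply: LBox2; rewrite maddCA; exact: h.
Qed.

(* Rule [LBox3], applied to a component [c] that [v] has and whose extensions
   towards [c ++ B :: e] it does not have, so that no label gets repeated. *)
Lemma der_box_extend c B e (d : label atom := B :: e) :
  (w, c ++ d) \in C -> (w, c ++ d, true, Box A) \in F -> (v, c) \in C ->
  (forall i, 0 < i <= size d -> (v, c ++ take i d) \notin C) ->
  derivable (hyp ks C ((v, c, false, B) :: F)) ->
  (forall i, 0 < i < size d ->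
    derivable (hyp ks ((v, c ++ take i d) :: C)
                   ((v, c ++ take i d, false, nth B d i) :: F))) ->
  derivable (hyp ks ((v, c ++ d) :: C) ((v, c ++ d, true, A) :: F)) ->
  derivable (hyp ks C F).
Proof.
move=> sC sA vC new.
have [X [Y [M [N [G E]]]]] := focus_two_worlds uks uC wk vk vw sC sA vC.
rewrite (E [::] [:: (v, c, false, B)]) ?(E [::] [::]) //=; last first.
  by move=> f; rewrite !inE => /eqP->.
rewrite {1}/cmp !facts_at_cons !xpair_eqE !eqxx /= => d1 d2 d3.
apply: (@LBox3 _ _ _ _ _ _ _ _ _ _ B e) => //; rewrite -/d.
- move=> i id; have := d2 i id; have inew := new i.
  (* As this site is absent from [C], no fact of [F] lies there, and the new component contains just
     the added formula, as in the premise of [LBox3]. *)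
  have {}inew : (v, c ++ take i d) \notin C.
    by apply: inew; case/andP: id => -> /ltnW.
  have neq : ((v, c ++ take i d) == (v, c) :> site) = false.
    by apply: contraNF inew => /eqP->.
  rewrite (E [:: _] [:: _]); first last.
  + by move=> f; rewrite inE => /eqP->; rewrite mem_head.
  + by move=> s; rewrite inE => /eqP->.
  rewrite /= /cmp !facts_at_cons /= ![(_, _, _) == _]xpair_eqE !eqxx !neq /=.
  by rewrite !(facts_at_new FC _ inew) [Z in derivable (Z +: _) -> _]maddCA.
- have inew : (v, c ++ d) \notin C by rewrite -[d]take_size; apply: new => /=.
  have neq : ((v, c ++ d) == (v, c) :> site) = false.
    by apply: contraNF inew => /eqP->.
  move: d3; rewrite (E [:: _] [:: _]); first last.
  + by move=> f; rewrite inE => /eqP->; rewrite mem_head.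
  + by move=> s; rewrite inE => /eqP->.
  rewrite /= /cmp !facts_at_cons /= ![(_, _, _) == _]xpair_eqE !eqxx !neq /=.
  by rewrite !(facts_at_new FC _ inew) [Z in derivable (Z +: _) -> _]maddCA.
Qed.


End BoxLeft.

End Sites.

(** * Maximal underivable states *)

Lemma count_lt (I : eqType) (p q : pred I) (s : seq I) x :
  (forall y, p y -> q y) -> x \in s -> q x -> ~~ p x -> count p s < count q s.
Proof.
move=> pq xs qx px; elim: s xs => //= y s IH; rewrite inE => /predU1P[<-|/IH lt_pq].
  by rewrite qx (negPf px) add0n add1n ltnS sub_count.
rewrite -addnS leq_add //; by case py: (p y); rewrite // pq.
Qed.

(** * Subformulas and lists of bounded length *)

Section Subformulas.
Variable atom : countType.
Implicit Types (A B : form atom).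

Fixpoint subs A : seq (form atom) :=
  A :: match A with
       | Atom _ => [::]
       | Neg A | Box A => subs A
       | And A B | Ann A B => subs A ++ subs B
       end.

Lemma subs_refl A : A \in subs A.
Proof. by case: A => *; rewrite inE eqxx. Qed.

Lemma subs_trans A B : A \in subs B -> {subset subs A <= subs B}.
Proof.
elim: B => [p|B IH|B IHB C IHC|B IH|B IHB C IHC] /=; rewrite inE;
  first (by move/eqP->); case/predU1P => [-> //|];
  rewrite ?mem_cat // => AB D DA; rewrite inE.
- by rewrite IH ?orbT.
- by rewrite mem_cat; case/orP: AB => h; rewrite ?(IHB h _ DA) ?(IHC h _ DA) ?orbT.
- by rewrite IH ?orbT.
- by rewrite mem_cat; case/orP: AB => h; rewrite ?(IHB h _ DA) ?(IHC h _ DA) ?orbT.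
Qed.

Lemma subs_size A B : A \in subs B -> form_size A <= form_size B.
Proof.
elim: B => [p|B IH|B IHB C IHC|B IH|B IHB C IHC] /=; rewrite inE;
  first (by move/eqP->); case/predU1P => [-> //|]; rewrite ?mem_cat //.
- by move/IH/leqW.
- case/orP=> [/IHB|/IHC] h; apply/leqW/(leq_trans h); by rewrite ?leq_addr ?leq_addl.
- by move/IH/leqW.
- case/orP=> [/IHB|/IHC] h; apply/leqW/(leq_trans h); by rewrite ?leq_addr ?leq_addl.
Qed.

Fixpoint seqs_upto n (s : seq (form atom)) : seq (label atom) :=
  if n is n'.+1 then [::] :: [seq x :: t | x <- s, t <- seqs_upto n' s]
  else [:: [::]].

Lemma mem_seqs_upto n s t : all (mem s) t -> size t <= n -> t \in seqs_upto n s.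
Proof.
elim: n t => [|n IH] [|x t] //= /andP[xs ts] tn; rewrite inE /=.
by apply/allpairsP; exists (x, t); split=> //; apply: IH.
Qed.

End Subformulas.

(** * The finite search space and its maximal underivable states *)

Section Search.
Variables (atom : countType) (root : form atom).
Implicit Types (w v : wname atom) (s t : site atom) (f : fact atom).
Implicit Types (a c : label atom) (b : bool) (A B : form atom) (p : atom).
Implicit Types (ks K : seq (wname atom)) (C H : seq (site atom)).
Implicit Types (F D E T : seq (fact atom)).

Let bound := form_size root.

(** Formulas have positive size, so the bound on the total size also bounds the length and leaves
    finitely many labels. *)
Definition good_label a := all (mem (subs root)) a && (label_size a <= bound).

Definition good_site s :=
  [&& good_label s.1.1, s.1.2 \in subs root & good_label s.2].

(** Bounding label and formula jointly gives an invariant of the search: the announcement rules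
    transfer size from the formula to the label without increasing the sum. *)
Definition good_fact f :=
  [&& good_site f.1.1, f.2 \in subs root
    & label_size f.1.1.2 + form_size f.2 <= bound].

Let all_labels := seqs_upto bound (subs root).
Let all_sites : seq (site atom) :=
  [seq (w, a) | w <- [seq (a, A) | a <- all_labels, A <- subs root],
                a <- all_labels].
Let all_facts : seq (fact atom) :=
  [seq (x, A) | x <- [seq (s, b) | s <- all_sites, b <- [:: true; false]],
                A <- subs root].

Lemma size_label a : size a <= label_size a.
Proof.
elim: a => //= A a IH; rewrite /label_size /= -add1n.
by apply: leq_add => //; apply: form_size_gt0.
Qed.

Lemma good_label_listed a : good_label a -> a \in all_labels.
Proof.
case/andP=> aS ab; apply: mem_seqs_upto => //.
exact: leq_trans (size_label a) ab.
Qed.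

Lemma good_site_listed s : good_site s -> s \in all_sites.
Proof.
case: s => [[a A] c] /and3P[/= /good_label_listed ha hA /good_label_listed hc].
by apply: allpairs_f => //; apply: allpairs_f.
Qed.

Lemma good_fact_listed f : good_fact f -> f \in all_facts.
Proof.
case: f => [[s b] A] /and3P[/= /good_site_listed hs hA _].
apply: allpairs_f => //; apply: allpairs_f => //.
by rewrite !inE; case: (b).
Qed.

Lemma good_label_prefix a c : good_label (a ++ c) -> good_label a.
Proof.
rewrite /good_label all_cat label_size_cat => /andP[/andP[-> _]] /=.
exact/leq_trans/leq_addr.
Qed.

Lemma good_site_prefix w a c : good_site (w, a ++ c) -> good_site (w, a).
Proof. by case/and3P=> h1 h2 /good_label_prefix h3; apply/and3P. Qed.

(** For [Recall] and [LBox3], which add announced formulas as facts: the size of such a formula is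
    already paid for by the label it is taken from. *)
Lemma good_fact_prefix w a A c b :
  good_site (w, a ++ A :: c) -> good_fact (w, a, b, A).
Proof.
move=> h; rewrite /good_fact /= (good_site_prefix h) /=.
case/and3P: h => _ _; rewrite -cat_rcons => /good_label_prefix.
rewrite /good_label all_rcons label_size_rcons => /andP[/andP[AS _] le].
by apply/andP; split; [exact: AS | exact: le].
Qed.

Lemma good_fact_sub s b A (c : bool) B :
  good_fact (s, b, A) -> B \in subs A -> good_fact (s, c, B).
Proof.
case/and3P=> /= gs AS le_n BA; rewrite /good_fact /= gs (subs_trans AS BA) /=.
by apply: leq_trans le_n; rewrite leq_add2l subs_size.
Qed.

Lemma good_fact_ann w a b A B (c : bool) :
  good_fact (w, a, b, Ann A B) -> good_fact (w, rcons a A, c, B).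
Proof.
case/and3P=> /= gs AB; rewrite addnS => le_n.
have AS : A \in subs root.
  by apply: subs_trans AB _ _; rewrite /= inE mem_cat subs_refl orbT.
have BS : B \in subs root.
  by apply: subs_trans AB _ _; rewrite /= inE mem_cat subs_refl !orbT.
case/and3P: gs => g1 g2 /andP[aS _].
rewrite /good_fact /= BS /good_site /= g1 g2 /good_label all_rcons /= aS !andbT.
rewrite label_size_rcons -addnA (ltnW le_n) andbT; apply/andP; split.
  exact: AS.
by apply: leq_trans (ltnW le_n); rewrite addnA leq_addr.
Qed.

(* What remains true of a fact consumed by a rule.  It is monotone in [T];
   atoms and boxes on the left are never consumed. *)
Definition discharged T (f : fact atom) : Prop :=
  let: (s, b, A) := f in
  match A with
  | Atom _ => False
  | Neg A => (s, ~~ b, A) \in T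
  | And A B => if b then (s, true, A) \in T /\ (s, true, B) \in T
               else (s, false, A) \in T \/ (s, false, B) \in T
  | Box A => if b then False else exists w, (w, s.2, false, A) \in T
  | Ann A B => if b then (s, false, A) \in T \/ (s.1, rcons s.2 A, true, B) \in T
               else (s, true, A) \in T /\ (s.1, rcons s.2 A, false, B) \in T
  end.

Lemma discharged_mono T T' f :
  {subset T <= T'} -> discharged T f -> discharged T' f.
Proof.
move=> TT'; case: f => [[s b] [p|A|A B|A|A B]] //=.
- exact: TT'.
- by case: b => -[]/TT' hA; [move=> /TT' hB | left | right].
- by case: b => // -[w /TT' h]; exists w.
- by case: b => -[]/TT' hA; [left | right | move=> /TT' hB].
Qed.

(* The facts [F] are those present in the hypersequent [hyp ks C F], the facts
   [D] those consumed. *)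
Record state_inv ks C F D : Prop := StateInv {
  inv_uks : uniq ks;
  inv_uC : uniq C;
  inv_site s : s \in C -> s.1 \in ks /\ good_site s;
  inv_fact f : f \in F ++ D -> f.1.1 \in C /\ good_fact f;
  inv_world w : w \in ks -> (w, w.1) \in C /\ (w, w.1, false, w.2) \in F ++ D;
  inv_done f : f \in D -> discharged (F ++ D) f
}.

(** Only sets of sites and of recorded facts are compared, so neither multiplicities nor moving a
    fact from [F] to [D] count as growth. By [inv_world] a new world would show up as a new site. *)
Definition maximal ks C F D : Prop := forall ks' C' F' D',
  state_inv ks' C' F' D' -> ~ derivable (hyp ks' C' F') ->
  {subset C <= C'} -> {subset F ++ D <= F' ++ D'} ->
  {subset C' <= C} /\ {subset F' ++ D' <= F ++ D}.

(** Every proper extension lowers the number of listed sites and facts still missing, and this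
    number is finite because the invariant admits only good ones. *)
Lemma maximal_state ks C F D : state_inv ks C F D -> ~ derivable (hyp ks C F) ->
  exists ks' C' F' D', [/\ state_inv ks' C' F' D', ~ derivable (hyp ks' C' F'),
    maximal ks' C' F' D', {subset C <= C'} & {subset F ++ D <= F' ++ D'}].
Proof.
pose missing C T := count [predC C] all_sites + count [predC T] all_facts.
have [m] := ubnP (missing C (F ++ D)).
elim: m ks C F D => // m IH ks C F D; rewrite ltnS => le_m I nd.
(* If no suitable state existed, the current one would have to be maximal: a proper extension of it
   would yield, by induction, a state that [none] excludes. *)
apply: NNPP => none; apply: (none).
exists ks, C, F, D; split=> // ks' C' F' D' I' nd' CC TT.
apply: NNPP => nsub; apply: none.
have leC : count [predC C'] all_sites <= count [predC C] all_sites.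
  by apply: sub_count => s /=; apply/contra/CC.
have leT : count [predC (F' ++ D')] all_facts <= count [predC (F ++ D)] all_facts.
  by apply: sub_count => f /=; apply/contra/TT.
have lt_m : missing C' (F' ++ D') < missing C (F ++ D).
  rewrite ltnNge; apply/negP => ge_m; apply: nsub; split=> x x'.
    apply/negPn/negP => xC.
    have lt : count [predC C'] all_sites < count [predC C] all_sites.
      apply: (count_lt (x := x)) => /=; rewrite ?x' //.
        by move=> s; apply/contra/CC.
      by apply: good_site_listed; case: (inv_site I' x').
    by move: ge_m; rewrite leqNgt -addSn leq_add.
  apply/negPn/negP => xT.
  have lt : count [predC (F' ++ D')] all_facts < count [predC (F ++ D)] all_facts.
    apply: (count_lt (x := x)) => /=; rewrite ?x' //.
      by move=> f; apply/contra/TT.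
    by apply: good_fact_listed; case: (inv_fact I' x').
  by move: ge_m; rewrite leqNgt -addnS leq_add.
have [k1 [C1 [F1 [D1 [I1 nd1 m1 sC1 sT1]]]]] := IH _ _ _ _ (leq_trans lt_m le_m) I' nd'.
exists k1, C1, F1, D1; split=> // x; [move/CC/sC1 | move/TT/sT1]; exact.
Qed.

(** * Saturation of a maximal underivable state *)

Section MaximalState.
Variables (ks : seq (wname atom)) (C : seq (site atom)) (F D : seq (fact atom)).
Hypotheses (I : state_inv ks C F D) (nd : ~ derivable (hyp ks C F)).
Hypothesis mx : maximal ks C F D.

Let uks := inv_uks I.
Let uC := inv_uC I.
Let FC f : f \in F -> f.1.1 \in C.
Proof. by move=> fF; case: (inv_fact I (f := f)); rewrite // mem_cat fF. Qed.
Let remFC g f : f \in rem g F -> f.1.1 \in C.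
Proof. by move=> /mem_rem; exact: FC. Qed.
Let Cks s : s \in C -> s.1 \in ks.
Proof. by case/(inv_site I). Qed.

(** The common form of a backward rule application: worlds [K], sites [H] and facts [E] are added,
    and [D0] is consumed. An underivable premise is again a state extending the given one, so
    maximality leaves it nothing new. *)
Lemma maximal_step K H E D0 F' :
    perm_eq F (D0 ++ F') -> uniq (K ++ ks) -> uniq (H ++ C) ->
    (forall s, s \in H -> s.1 \in K ++ ks /\ good_site s) ->
    (forall f, f \in E -> f.1.1 \in H ++ C /\ good_fact f) ->
    (forall w, w \in K -> (w, w.1) \in H /\ (w, w.1, false, w.2) \in E) ->
    (forall f, f \in D0 -> discharged (E ++ F ++ D) f) ->
    ~ derivable (hyp (K ++ ks) (H ++ C) (E ++ F')) ->
  {subset H <= C} /\ {subset E <= F ++ D}.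
Proof.
move=> FF' uK uH Hgood Egood KE D0d nd'.
(* Consumed facts pass from the present part to the past part, so nothing recorded is lost. *)
have eqT : (E ++ F') ++ D0 ++ D =i E ++ F ++ D.
  apply: perm_mem; rewrite -catA perm_cat2l catA perm_cat2r perm_catC perm_sym.
  exact: FF'.
have [|//|s sC|f fT|HC ET] := @mx (K ++ ks) (H ++ C) (E ++ F') (D0 ++ D).
- split=> //.
  + move=> s; rewrite mem_cat => /orP[/Hgood//|/(inv_site I)[sk ->]].
    by rewrite mem_cat sk orbT.
  + move=> f; rewrite eqT mem_cat => /orP[/Egood//|/(inv_fact I)[fC ->]].
    by rewrite mem_cat fC orbT.
  + move=> w; rewrite eqT !mem_cat => /orP[/KE[-> ->]//|/(inv_world I)[-> h]].
    by rewrite -mem_cat h !orbT.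
  + move=> f; rewrite mem_cat => /orP[/D0d|/(inv_done I)];
      apply: discharged_mono => g; rewrite eqT // [g \in E ++ _]mem_cat => ->.
    exact: orbT.
- by rewrite mem_cat sC orbT.
- by rewrite eqT mem_cat fT orbT.
split=> [s sH|f fE]; first by apply: HC; rewrite mem_cat sH.
by apply: ET; rewrite eqT mem_cat fE.
Qed.

Lemma maximal_add E : (forall f, f \in E -> f.1.1 \in C /\ good_fact f) ->
  ~ derivable (hyp ks C (E ++ F)) -> {subset E <= F ++ D}.
Proof.
by move=> Egood nd'; case: (@maximal_step [::] [::] E [::] F).
Qed.

Lemma maximal_use f E : f \in F ->
  (forall g, g \in E -> g.1.1 \in C /\ good_fact g) ->
  discharged (E ++ F ++ D) f -> ~ derivable (hyp ks C (E ++ rem f F)) ->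
  {subset E <= F ++ D}.
Proof.
move=> fF Egood fd nd'.
case: (@maximal_step [::] [::] E [:: f] (rem f F)) => //.
- exact: perm_to_rem.
- by move=> g; rewrite inE => /eqP->.
Qed.

(** Contrapositive use of maximality: a premise that would create a missing site must be
    derivable. *)
Lemma maximal_new t E F' D0 : perm_eq F (D0 ++ F') -> t \notin C ->
  t.1 \in ks -> good_site t ->
  (forall g, g \in E -> g.1.1 \in t :: C /\ good_fact g) ->
  (forall f, f \in D0 -> discharged (E ++ F ++ D) f) ->
  derivable (hyp ks (t :: C) (E ++ F')).
Proof.
move=> FF' tC tk tg Egood D0d; apply: NNPP => nd'.
have [||||||||sub _] := @maximal_step [::] [:: t] E D0 F' => //.
- by rewrite /= tC uC.
- by move=> s; rewrite inE => /eqP->.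
by have := sub t (mem_head _ _); rewrite (negPf tC).
Qed.

Lemma hyp_rem f : f \in F -> hyp ks C F = hyp ks C (f :: rem f F).
Proof. by move=> fF; apply: perm_hyp (perm_refl _) (perm_refl _) (perm_to_rem fF). Qed.

Let T := F ++ D.

Lemma fact_site f : f \in T -> f.1.1 \in C.
Proof. by case/(inv_fact I). Qed.

Lemma fact_good f : f \in T -> good_fact f.
Proof. by case/(inv_fact I). Qed.

(** The case split behind all saturation lemmas: a fact still present can be made principal, and for
    a consumed one [discharged] is already the Hintikka clause, or false for atoms and left
    boxes. *)
Lemma fact_cases f : f \in T -> f \in F \/ discharged T f.
Proof. by rewrite mem_cat => /orP[|/(inv_done I)]; [left | right]. Qed.

Lemma max_new w a A : (w, rcons a A) \in C -> (w, a) \in C.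
Proof.
move=> sC; have wk := Cks sC; have [_ sg] := inv_site I sC.
apply/negPn/negP => tC; apply: nd; apply: (der_new uks uC FC wk sC tC).
apply: (@maximal_new _ [::] F [::]) => //.
by move: sg; rewrite -cats1 => /good_site_prefix.
Qed.

(** The component the world was created with is shortened to the empty label by repeated use of
    [max_new]. *)
Lemma max_root v : v \in ks -> (v, [::]) \in C.
Proof.
case/(inv_world I) => + _; elim/last_ind: (v.1) => // a A IH sC.
exact/IH/(max_new sC).
Qed.

Lemma max_recall w a A : (w, rcons a A) \in C -> (w, a, true, A) \in T.
Proof.
move=> sC; have wk := Cks sC; have [_ sg] := inv_site I sC.
have tC := max_new sC.
apply: (@maximal_add [:: (w, a, true, A)]); last exact: mem_head.
  move=> f; rewrite inE => /eqP->; split=> //.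
  by apply: (@good_fact_prefix _ _ _ [::]); rewrite cats1.
by move/(der_recall uks uC wk tC sC).
Qed.

Lemma max_consistent w a p :
  (w, a, true, Atom p) \in T -> (w, a, false, Atom p) \notin T.
Proof.
move=> Tl; apply/negP => Tr; have sC := fact_site Tl; have wk := Cks sC.
have [Fl|[]] := fact_cases Tl; have [Fr|[]] := fact_cases Tr.
apply: nd; rewrite (hyp_rem Fl).
have Fr' : (w, a, false, Atom p) \in rem (w, a, true, Atom p) F.
  by move: Fr; rewrite (perm_mem (perm_to_rem Fl)) inE => /predU1P[[]|].
have Frem := perm_to_rem Fr'; rewrite (perm_hyp (perm_refl _) (perm_refl _)
  (F' := [:: (w, a, true, Atom p), (w, a, false, Atom p)
           & rem (w, a, false, Atom p) (rem (w, a, true, Atom p) F)])).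
  by apply: der_axiom => // f /mem_rem/remFC.
by rewrite perm_cons.
Qed.

Lemma max_atom w a b A p :
  (w, rcons a A, b, Atom p) \in T -> (w, a, b, Atom p) \in T.
Proof.
move=> Tp; have tC := fact_site Tp; have wk := Cks tC; have sC := max_new tC.
have [Fp|[]] := fact_cases Tp.
apply: (@maximal_add [:: (w, a, b, Atom p)]); last exact: mem_head.
  move=> f; rewrite inE => /eqP->; split=> //.
  case/and3P: (fact_good Tp) => /= gs ps le_n.
  rewrite /good_fact /= ps (@good_site_prefix w a [:: A]) ?cats1 //=.
  by apply: leq_trans le_n; rewrite label_size_rcons leq_add2r leq_addr.
move=> d; apply: nd; rewrite (hyp_rem Fp); apply: der_atom => //.
move: d; rewrite (perm_hyp (perm_refl _) (perm_refl _)
  (F' := [:: (w, a, b, Atom p), (w, rcons a A, b, Atom p)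
           & rem (w, rcons a A, b, Atom p) F])) //.
by rewrite /= perm_cons perm_to_rem.
Qed.

Lemma max_neg w a b A : (w, a, b, Neg A) \in T -> (w, a, ~~ b, A) \in T.
Proof.
move=> Tf; have sC := fact_site Tf; have wk := Cks sC; have gf := fact_good Tf.
have [Ff|//] := fact_cases Tf.
apply: (@maximal_use _ [:: (w, a, ~~ b, A)] Ff); last exact: mem_head.
- move=> g; rewrite inE => /eqP->; split=> //; apply: good_fact_sub gf _.
  by rewrite /= inE subs_refl orbT.
- exact: mem_head.
move=> d; apply: nd; rewrite (hyp_rem Ff); apply: der_neg => //.
Qed.

Lemma max_and_left w a A B : (w, a, true, And A B) \in T ->
  (w, a, true, A) \in T /\ (w, a, true, B) \in T.
Proof.
move=> Tf; have sC := fact_site Tf; have wk := Cks sC; have gf := fact_good Tf.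
have [Ff|//] := fact_cases Tf.
have sub : {subset [:: (w, a, true, A); (w, a, true, B)] <= T}.
  apply: (maximal_use Ff).
  - move=> g; rewrite !inE => /orP[]/eqP->; split=> //; apply: good_fact_sub gf _;
    by rewrite /= inE mem_cat subs_refl !orbT.
  - by rewrite /= !inE !eqxx orbT.
  move=> d; apply: nd; rewrite (hyp_rem Ff); apply: der_and_left => //.
by split; apply: sub; rewrite !inE eqxx ?orbT.
Qed.

Lemma max_and_right w a A B : (w, a, false, And A B) \in T ->
  (w, a, false, A) \in T \/ (w, a, false, B) \in T.
Proof.
move=> Tf; have sC := fact_site Tf; have wk := Cks sC; have gf := fact_good Tf.
have [Ff|//] := fact_cases Tf; set f := (w, a, false, And A B) in Ff.
(* One of the two premises is underivable, and that premise decides which conjunct is recorded. *)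
have [dA|ndA] := classic (derivable (hyp ks C ((w, a, false, A) :: rem f F))).
- right; apply: (@maximal_use _ [:: (w, a, false, B)] Ff); last exact: mem_head.
  + move=> g; rewrite inE => /eqP->; split=> //; apply: good_fact_sub gf _.
    by rewrite /= inE mem_cat subs_refl !orbT.
  + by right; exact: mem_head.
  move=> d; apply: nd; rewrite (hyp_rem Ff); apply: der_and_right => //.
- left; apply: (@maximal_use _ [:: (w, a, false, A)] Ff) => //; last exact: mem_head.
  + move=> g; rewrite inE => /eqP->; split=> //; apply: good_fact_sub gf _.
    by rewrite /= inE mem_cat subs_refl !orbT.
  + by left; exact: mem_head.
Qed.

Lemma max_ann_left w a A B : (w, a, true, Ann A B) \in T ->
  (w, a, false, A) \in T \/ (w, rcons a A, true, B) \in T.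
Proof.
move=> Tf; have sC := fact_site Tf; have wk := Cks sC; have gf := fact_good Tf.
have [Ff|//] := fact_cases Tf; set f := (w, a, true, Ann A B) in Ff.
have gt : good_fact (w, rcons a A, true, B) by apply: good_fact_ann gf.
have gts : good_site (w, rcons a A) by case/and3P: gt.
have [dA|ndA] := classic (derivable (hyp ks C ((w, a, false, A) :: rem f F))).
(* Were the [rcons a A] component missing, the right premise would be derivable by [maximal_new],
   hence so would the conclusion. *)
- right; have [tC|tC] := boolP ((w, rcons a A) \in C); last first.
    case: nd; rewrite (hyp_rem Ff); apply: der_ann_left_new => //; first exact: remFC.
    apply: (@maximal_new _ [:: (w, rcons a A, true, B)] _ [:: f]) => //.
    + exact: perm_to_rem.
    + by move=> g; rewrite inE => /eqP->; rewrite mem_head.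
    + by move=> g; rewrite inE => /eqP->; right; exact: mem_head.
  apply: (@maximal_use _ [:: (w, rcons a A, true, B)] Ff); last exact: mem_head.
  + by move=> g; rewrite inE => /eqP->.
  + by right; exact: mem_head.
  move=> d; apply: nd; rewrite (hyp_rem Ff); apply: der_ann_left => //.
- left; apply: (@maximal_use _ [:: (w, a, false, A)] Ff) => //; last exact: mem_head.
  + move=> g; rewrite inE => /eqP->; split=> //; apply: good_fact_sub gf _.
    by rewrite /= inE mem_cat subs_refl !orbT.
  + by left; exact: mem_head.
Qed.

Lemma max_ann_right w a A B : (w, a, false, Ann A B) \in T ->
  (w, a, true, A) \in T /\ (w, rcons a A, false, B) \in T.
Proof.
move=> Tf; have sC := fact_site Tf; have wk := Cks sC; have gf := fact_good Tf.
have [Ff|//] := fact_cases Tf; set f := (w, a, false, Ann A B) in Ff.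
have gt : good_fact (w, rcons a A, false, B) by apply: good_fact_ann gf.
have gts : good_site (w, rcons a A) by case/and3P: gt.
have gA : good_fact (w, a, true, A).
  by apply: good_fact_sub gf _; rewrite /= inE mem_cat subs_refl !orbT.
pose E := [:: (w, a, true, A); (w, rcons a A, false, B)].
have fd : discharged (E ++ F ++ D) f by rewrite /= !inE !eqxx ?orbT.
have [tC|tC] := boolP ((w, rcons a A) \in C); last first.
  case: nd; rewrite (hyp_rem Ff); apply: der_ann_right_new => //; first exact: remFC.
  apply: (@maximal_new _ E _ [:: f]) => //.
  + exact: perm_to_rem.
  + by move=> g; rewrite !inE => /orP[]/eqP->; rewrite ?eqxx ?sC ?orbT.
  + by move=> g; rewrite inE => /eqP->.
have sub : {subset E <= T}.
  apply: (maximal_use Ff) => //.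
    by move=> g; rewrite !inE => /orP[]/eqP->.
  move=> d; apply: nd; rewrite (hyp_rem Ff); apply: der_ann_right => //.
by split; apply: sub; rewrite !inE eqxx ?orbT.
Qed.

Lemma max_box_right w a A : (w, a, false, Box A) \in T ->
  exists v, (v, a, false, A) \in T.
Proof.
move=> Tf; have sC := fact_site Tf; have wk := Cks sC; have gf := fact_good Tf.
have [Ff|//] := fact_cases Tf; set f := (w, a, false, Box A) in Ff.
pose v : wname atom := (a, A); exists v.
(* If a world of this name exists, [inv_world] already records [A] on its right, and no second copy
   is created. Otherwise [RBox] supplies an underivable extension, and maximality records the
   fact. *)
have [/(inv_world I)[]//|vk] := boolP (v \in ks).
have vC : (v, a) \notin C by apply: contra vk => /Cks.
have gA : good_fact (w, a, false, A).
  by apply: good_fact_sub gf _; rewrite /= inE subs_refl !orbT.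
have gv : good_fact (v, a, false, A).
  case/and3P: gA => /and3P[/= g1 g2 g3] AS le_n.
  by rewrite /good_fact /good_site /= g3 AS.
have [|||s|g|u|g||_] :=
  @maximal_step [:: v] [:: (v, a)] [:: (v, a, false, A)] [:: f] (rem f F).
- exact: perm_to_rem.
- by rewrite /= vk uks.
- by rewrite /= vC uC.
- by rewrite inE => /eqP->; rewrite mem_head; case/and3P: gv.
- by rewrite inE => /eqP->; rewrite mem_head.
- by rewrite inE => /eqP->; rewrite !mem_head.
- by rewrite inE => /eqP->; exists v; rewrite mem_head.
- move=> d; apply: nd; rewrite (hyp_rem Ff); apply: der_box_right vk d _ => //.
  exact: remFC.
by apply; exact: mem_head.
Qed.

(** Induction on [a] from its end: the last formula is dropped until a label of [v] is reached, at
    the latest the empty one by [max_root]. *)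
Lemma longest_component v a : v \in ks -> (v, a) \notin C ->
  exists c B e, [/\ a = c ++ B :: e, (v, c) \in C &
    forall i, 0 < i <= size (B :: e) -> (v, c ++ take i (B :: e)) \notin C].
Proof.
move=> vk; elim/last_ind: a => [|a A IH] aC; first by rewrite max_root in aC.
have [sC|/IH[c [B [e [Ea cC new]]]]] := boolP ((v, a) \in C).
  exists a, A, [::]; rewrite -cats1 in aC *; split=> // -[|[|]] //.
exists c, B, (rcons e A); rewrite Ea rcons_cat; split=> // i /andP[i0].
rewrite -rcons_cons size_rcons leq_eqVlt => /predU1P[->|].
  by rewrite -(size_rcons _ A) take_size -rcons_cat; rewrite Ea in aC.
rewrite ltnS => ie; rewrite -cats1 takel_cat //.
by apply: new; rewrite i0.
Qed.

(** If [v] lacks [a], all premises of [LBox3] but the first create a missing component of [v] and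
    are derivable by maximality. So the first is underivable, which places [B] on the right at the
    longest prefix [c] that [v] has. *)
Lemma max_box_left w a A v : (w, a, true, Box A) \in T -> v \in ks ->
  (v, a, true, A) \in T \/
  exists c B e, a = rcons c B ++ e /\ (v, c, false, B) \in T.
Proof.
move=> Tf vk; have sC := fact_site Tf; have wk := Cks sC; have gf := fact_good Tf.
have [Ff|//] := fact_cases Tf; set f := (w, a, true, Box A) in Ff.
have gA : good_fact (w, a, true, A).
  by apply: good_fact_sub gf _; rewrite /= inE subs_refl !orbT.
have gva : good_site (v, a).
  have [/(inv_site I)[_]] := inv_world I vk.
  by case/and3P=> /= v1 v2 _ _; case/and3P: gA => /and3P[/= _ _ g3] _ _; apply/and3P.
have gv : good_fact (v, a, true, A).
  by case/and3P: gA => _ /= AS le_n; apply/and3P.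
have [vC|vC] := boolP ((v, a) \in C).
  left; apply: (@maximal_add [:: (v, a, true, A)]); last exact: mem_head.
    by move=> g; rewrite inE => /eqP->.
  (* The box acts on its own world through [LBox1] and on another one through [LBox2]. *)
  have [->|vw] := eqVneq v w.
    move=> d; apply: nd; rewrite (hyp_rem Ff); apply: der_box_self => //.
    move: d; rewrite (perm_hyp (perm_refl _) (perm_refl _)
      (F' := [:: f, (w, a, true, A) & rem f F])) //.
    rewrite (perm_trans (y := (w, a, true, A) :: f :: rem f F)) //.
      by rewrite perm_cons perm_to_rem.
    by rewrite (perm_catCA [:: _] [:: _]).
  exact/(contra_not (der_box_other uks uC wk vk vw sC Ff vC)).
right; have [c [B [e [Ea cC new]]]] := longest_component vk vC.
have vw : v != w by apply: contraNneq vC => ->.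
exists c, B, e; rewrite cat_rcons; split=> //.
apply: (@maximal_add [:: (v, c, false, B)]); last exact: mem_head.
  move=> g; rewrite inE => /eqP->; split=> //.
  by apply: (@good_fact_prefix _ _ _ e); rewrite -Ea.
move=> d; apply: nd; rewrite {}/f in Ff; subst a.
apply: (der_box_extend uks uC FC wk vk vw sC Ff cC new d) => [i id|].
- have ine : 0 < i <= size (B :: e) by case/andP: id => -> /ltnW.
  (* The full label is split just before its formula number [i], counted from zero after [c], so
     that [good_fact_prefix] bounds the fact which the intermediate premise adds. *)
  have ge : good_site
      (v, (c ++ take i (B :: e)) ++ nth B (B :: e) i :: drop i.+1 (B :: e)).
    by rewrite -catA -drop_nth ?cat_take_drop //; case/andP: id.
  apply: (@maximal_new _ [:: _] F [::]) => //; first exact: new.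
    exact: good_site_prefix ge.
  move=> g; rewrite inE => /eqP->; rewrite mem_head; split=> //.
  exact: good_fact_prefix ge.
- apply: (@maximal_new _ [:: _] F [::]) => //.
  by move=> g; rewrite inE => /eqP->; rewrite mem_head.
Qed.

Lemma maximal_hintikka : hintikka
  (fun (w : {w | w \in ks}) a => (val w, a) \in C)
  (fun (w : {w | w \in ks}) a b A => (val w, a, b, A) \in T).
Proof.
split=> [w a A sC|w a b A|w a p Tp|w a b A p|w a b A|w a A B|w a A B|w a A Tf v|w a A||].
- by split; [exact: max_new sC | exact: max_recall].
- exact: fact_site.
- exact/negP/max_consistent.
- exact: max_atom.
- exact: max_neg.
- exact: max_and_left.
- exact: max_and_right.
- by apply: max_box_left Tf _; exact: valP.
- by case/max_box_right => v Tv; exists (exist _ v (Cks (fact_site Tv))).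
- by move=> w a A B; exact: max_ann_left.
- by move=> w a A B; exact: max_ann_right.
Qed.

End MaximalState.

(** * Completeness *)

Lemma valid_derivable : valid root ->
  derivable [mset [mset [at [::] | mset0 => [mset root]]]].
Proof.
move=> vA; apply: NNPP => nd.
(* With this name the initial world satisfies [inv_world] just like a world created by [RBox] for
   [root] at the empty label. *)
pose r : wname atom := ([::], root).
pose C : seq (site atom) := [:: (r, [::])].
pose F : seq (fact atom) := [:: (r, [::], false, root)].
have gr : good_fact (r, [::], false, root).
  by rewrite /good_fact /good_site /= /good_label /= subs_refl leqnn.
have I : state_inv [:: r] C F [::].
  split=> // [s|f|w]; rewrite !inE => /eqP->; rewrite ?mem_head //.
  by split=> //; case/and3P: gr.
have hypE : hyp [:: r] C F = [mset [mset [at [::] | mset0 => [mset root]]]].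
  rewrite /hyp /= eqxx (madd0 (cmp (r, [::]) F)) madd0.
  by rewrite /cmp !facts_at_cons /= !xpair_eqE !eqxx /= madd0.
rewrite -hypE in nd.
have [ks' [C' [F' [D' [I' nd' m' CC TT]]]]] := maximal_state I nd.
have rk : r \in ks' by case: (inv_site I' (CC _ (mem_head _ _))).
apply: (hintikka_not_valid (maximal_hintikka I' nd' m') (w := exist _ r rk)) vA.
exact/TT/mem_head.
Qed.

End Search.

Theorem mainTheorem3 (atom : countType) (A : form atom) :
  valid A ->
  derivable [mset [mset [at [::] | mset0 => [mset A]]]]%mset.
Proof. exact: valid_derivable. Qed.
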